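(* Let $\Gamma=(N,(A_i)_{i\in N},(u_i)_{i\in N})$ be a finite normal-form game, and let $K\ge1$. Suppose that a run of iterative elimination via potential proofs (IEPP) on $\Gamma$ produces action sets $A_i=A_i^0\supseteq A_i^1\supseteq\cdots\supseteq A_i^K$ ($i\in N$), eliminated sets $A_i'^{\ell}=A_i^\ell\setminus A_i^{\ell+1}$, and potentials $h^\ell:\times_{i\in N}\Delta(A_i^\ell)\to\mathbb{R}$ for $0\le\ell<K$. Suppose that each $h^\ell$ extends to a tangential, Lipschitz-differentiable function $\hat h^\ell:\times_{i\in N}\Delta(A_i)\to\mathbb{R}$ satisfying $\partial\hat h^\ell(x)/\partial x_i(a_i)=0$ for any $i\in N$, $a_i\in A_i\setminus A_i^\ell$ and $x\in\times_{j\in N}\Delta(A_j^\ell)$. Then there exist strictly positive $\epsilon(0),\epsilon(1),\dots,\epsilon(K-1)$ such that for all $x\in\times_{i\in N}\Delta(A_i)$, $$\sum_{\ell=0}^{K-1}\sum_{i\in N}\big\langle\epsilon(\ell)\nabla_i\hat h^\ell(x),\nabla_iu_i(x)\big\rangle\ \ge\ \sum_{a\in A}\Big(\prod_{j\in N}x_j(a_j)\Big)\,\mathbb{I}\big[\exists\,i\in N,\ a_i\notin A_i^K\big].$$ As a consequence, if all players implement online gradient ascent for $T$ periods with common non-increasing step sizes $\eta_t$ satisfying $1/\eta_T=o(T)$ and $\sum_{t=1}^T\eta_t=o(T)$, then as $T\to\infty$, in time-average, outcomes $a$ with $a_i\in A_i\setminus A_i^K$ for some $i$ occur with vanishing probability: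 $\frac1T\sum_{t=1}^T\sum_{a\in A}\big(\prod_jx_j^t(a_j)\big)\mathbb{I}[\exists i\in N,\,a_i\notin A_i^K]\to0$.
   Context: Finite normal-form game: $N$ is a finite set of players, $A_i$ is a finite nonempty action set, $A=\times_iA_i$, and $u_i:A\to\mathbb{R}$. $\Delta(A_i)=\{x_i\in\mathbb{R}^{A_i}:x_i\ge0,\sum x_i(a_i)=1\}$, and utilities extend multilinearly to mixed profiles by $u_i(x)=\sum_a(\prod_jx_j(a_j))u_i(a)$. $\nabla_i$ denotes the gradient in the coordinates $x_i\in\mathbb{R}^{A_i}$, and $\mathbb{I}[\cdot]$ is the 0/1 indicator. For $A_i^\ell\subseteq A_i$, $\Delta(A_i^\ell)$ is identified with the face $\{x_i\in\Delta(A_i):x_i(a_i)=0\ \forall a_i\in A_i\setminus A_i^\ell\}$; ''extends'' means $\hat h^\ell$ agrees with $h^\ell$ on this face. Differentiable functions on products of simplices are understood as given by $C^1$ functions on a neighbourhood in the ambient Euclidean space, with $\nabla$ the corresponding gradient. $h$ is Lipschitz-differentiable if $\nabla h$ is Lipschitz on the domain. $h$ is tangential if $\nabla h(x)$ is in the tangent cone of the domain at $x$ for every $x$, i.e. for every $i$: $\sum_{a_i}\partial h(x)/\partial x_i(a_i)=0$, and $\partial h(x)/\partial x_i(a_i)\ge0$ whenever $x_i(a_i)=0$. Elimination via a potential proof: in a game with action sets $(A_i)$, sets $A_i'\subsetneq A_i$ (not all empty) are eliminated via a potential proof by $h:\times_i\Delta(A_i)\to\mathbb{R}$ if $h$ is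 Lipschitz-differentiable, tangential, and for all $x\in\times_i\Delta(A_i)$, $$\sum_{i\in N}\langle\nabla_ih(x),\nabla_iu_i(x)\rangle\ge\sum_{a\in A}\Big(\prod_{j}x_j(a_j)\Big)\mathbb{I}[\exists i\in N,\ a_i\in A_i'].$$ IEPP: start with $A_i^0=A_i$. At step $\ell=0,\dots,K-1$, in the subgame $\Gamma^\ell=(N,(A_i^\ell)_i,(u_i)_i)$ (utilities restricted to $\times_iA_i^\ell$), choose sets $A_i'^{\ell}\subsetneq A_i^\ell$, not all empty, that are eliminated via a potential proof by some $h^\ell:\times_i\Delta(A_i^\ell)\to\mathbb{R}$ in $\Gamma^\ell$, and set $A_i^{\ell+1}=A_i^\ell\setminus A_i'^{\ell}$. Online gradient ascent: from an arbitrary $x_i^1\in\Delta(A_i)$, $x_i^{t+1}=\Pi_{\Delta(A_i)}[x_i^t+\eta_t\nabla_iu_i(x^t)]$, with $\Pi$ Euclidean projection; step sizes are positive and may depend on the horizon $T$. *)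

(* Defs.v *)
From mathcomp Require Import all_boot all_order all_algebra.
From mathcomp Require Import all_classical all_reals all_analysis.
Import Order.TTheory GRing.Theory Num.Theory numFieldNormedType.Exports.
Set Implicit Arguments.
Unset Strict Implicit.
Unset Printing Implicit Defensive.
Local Open Scope classical_set_scope.
Local Open Scope ring_scope.

(* The ambient Euclidean space \prod_i R^(A i), realized as row vectors indexed
   by the pairs (i, a) with a : A i so that the library's topology and
   derivatives apply. Its library norm is the sup norm; the Lipschitz property
   below does not depend on this choice. *)
Definition profile_space (R : realType) (N : finType) (A : N -> finType) :=
  'rV[R]_#|{: {i : N & A i}}|.

Definition pure_profile (N : finType) (A : N -> finType) :=
  {dffun forall i : N, A i}.

Definition simplex (R : realType) (S : finType) : set (S -> R) :=
  [set p | (forall a, 0 <= p a) /\ \sum_a p a = 1].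

Arguments simplex : clear implicits.

Section FiniteGame.
Context {R : realType} {N : finType} {A : N -> finType}.
Local Notation space := (profile_space R A).
Local Notation pure := (pure_profile A).

Definition coordinate (i : N) (a : A i) : 'I_#|{: {i : N & A i}}| :=
  enum_rank (Tagged A a).

Definition strategy (x : space) (i : N) (a : A i) : R := x ord0 (coordinate a).

Definition mixed_profile : set space :=
  [set x | forall i, simplex R (A i) (@strategy x i)].

Definition pure_prob (x : space) (a : pure) : R := \prod_j strategy x (a j).

Definition mixed_utility (v : pure -> R) (x : space) : R :=
  \sum_(a : pure) pure_prob x a * v a.

(* Probability under x that some player i plays an action in B i. *)
Definition prob_some (x : space) (B : forall i, {set A i}) : R :=
  \sum_(a : pure) pure_prob x a * [exists i, a i \in B i]%:R.

Definition partial (f : space -> R) (x : space) (i : N) (a : A i) : R :=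
  'D_(delta_mx ord0 (coordinate a)) f x.

Definition gradient (f : space -> R) (x : space) : space :=
  \row_k partial f x (tagged (enum_val k)).

Definition C1_near (D : set space) (f : space -> R) : Prop :=
  exists U : set space, [/\ open U, D `<=` U &
    forall x, U x -> differentiable f x /\ {for x, continuous (gradient f)}].

Definition lipschitz_differentiable (f : space -> R) : Prop :=
  C1_near mixed_profile f /\
  exists k : R, k.-lipschitz_mixed_profile (gradient f).

Definition tangential (f : space -> R) : Prop :=
  forall x, mixed_profile x -> forall i : N,
    \sum_(a : A i) partial f x a = 0 /\
    forall a : A i, strategy x a = 0 -> 0 <= partial f x a.

Definition eliminated_via_potential (u : N -> pure -> R)
    (A' : forall i, {set A i}) (h : space -> R) : Prop :=
  [/\ forall i, A' i \proper [set: A i]%SET,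
      exists i, A' i != finset.set0,
      lipschitz_differentiable h,
      tangential h &
      forall x, mixed_profile x ->
        \sum_i \sum_(a : A i) partial h x a * partial (mixed_utility (u i)) x a
          >= prob_some x A'].

(* z is a point of C nearest to y in the Euclidean distance of R^S. *)
Definition is_projection (S : finType) (C : set (S -> R)) (y z : S -> R) :=
  C z /\ forall w, C w ->
    Num.sqrt (\sum_a (y a - z a) ^+ 2) <= Num.sqrt (\sum_a (y a - w a) ^+ 2).

Definition gradient_ascent_step (u : N -> pure -> R) (eta : R)
    (x y : space) : Prop :=
  forall i : N, is_projection (simplex R (A i))
    (fun a : A i => strategy x a + eta * partial (mixed_utility (u i)) x a)
    (fun a : A i => strategy y a).

(* For each horizon T, the steps eta T t and profiles x T t matter only for
   1 <= t <= T; the initial profile x T 1 may also depend on T. *)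
Definition gradient_ascent (u : N -> pure -> R) (eta : nat -> nat -> R)
    (x : nat -> nat -> space) : Prop :=
  forall T, (0 < T)%N ->
    mixed_profile (x T 1%N) /\
    forall t, (1 <= t < T)%N -> gradient_ascent_step u (eta T t) (x T t) (x T t.+1).

Definition admissible_steps (eta : nat -> nat -> R) : Prop :=
  [/\ forall T t, (1 <= t <= T)%N -> 0 < eta T t,
      forall T s t, (1 <= s)%N -> (s <= t)%N -> (t <= T)%N -> eta T t <= eta T s,
      (fun T : nat => ((eta T T)^-1)%R) =o_\oo (fun T : nat => T%:R : R) &
      (fun T : nat => (\sum_(1 <= t < T.+1) eta T t)%R)
        =o_\oo (fun T : nat => T%:R : R)].

End FiniteGame.

Section Subgame.
Context {R : realType} {N : finType} {A : N -> finType}.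
Implicit Types B C : forall i, {set A i}.

Definition subaction B : N -> finType :=
  fun i => {a : A i | a \in B i} : finType.

Definition subutility B (u : N -> pure_profile A -> R) :
    N -> pure_profile (subaction B) -> R :=
  fun i a => u i [ffun j => val (a j)].

Definition subaction_set B C (i : N) : {set subaction B i} :=
  [set a : subaction B i | val a \in C i]%SET.

Definition face B : set (profile_space R A) :=
  [set x | mixed_profile x /\
           forall i (a : A i), a \notin B i -> strategy x a = 0].

(* Maps [face B] bijectively onto the mixed profiles of the subgame; its
   inverse is the identification of \prod_i Delta(B i) with that face. *)
Definition to_subgame B (x : profile_space R A) :
    profile_space R (subaction B) :=
  \row_k strategy x (val (tagged (enum_val k))).

Definition iepp_run (u : N -> pure_profile A -> R) (K : nat)
    (Al A'l : nat -> forall i, {set A i})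
    (h : forall l, profile_space R (subaction (Al l)) -> R) : Prop :=
  (forall i, Al 0%N i = [set: A i]%SET) /\
  forall l, (l < K)%N ->
    [/\ forall i, A'l l i \proper Al l i,
        eliminated_via_potential (@subutility (Al l) u)
          (subaction_set (Al l) (A'l l)) (h l) &
        forall i, Al l.+1 i = (Al l i :\: A'l l i)%SET].

End Subgame.

Arguments iepp_run {R N A} u K Al A'l h.

(* Main.v *)
Require Import Defs.
From mathcomp Require Import all_boot all_order all_algebra.
From mathcomp Require Import all_classical all_reals all_analysis.
From mathcomp Require Import ring lra.
Import Order.TTheory GRing.Theory Num.Theory numFieldNormedType.Exports.
Set Implicit Arguments.
Unset Strict Implicit.
Unset Printing Implicit Defensive.
Local Open Scope classical_set_scope.
Local Open Scope ring_scope.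

(* On the face where stage l takes place, the restricted partial derivatives of
   the extension agree with those of the stage potential, so the gain
   F_l = <grad hhat_l, grad u> dominates the probability of the actions
   eliminated at stage l. A general profile lies within distance p_l of that
   face, p_l being the probability of an action outside A^l, and F_l is
   Lipschitz; hence F_l >= p_(l+1) - c_l p_l everywhere, and rapidly decreasing
   weights make the weighted sum of the F_l telescope down to p_K.
   Along projected gradient ascent, a tangential function satisfies
   H(x_(t+1)) - H(x_t) >= eta_t F(x_t) - C eta_t^2: the error of the projection
   is a normal vector at x_(t+1), which pairs nonpositively with the gradient of
   H there. Dividing by eta_t and summing by parts bounds the time average. *)

(** * Bounded Lipschitz functions and their closure properties *)

Section BoundedLipschitz.
Context {R : realType} {V : normedModType R}.
Implicit Types (D : set V) (f g : V -> R).

(** The bound on values is carried along with the Lipschitz estimate because the estimate for a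
    product uses bounds on both factors. *)
Definition bounded_lipschitz D f := exists2 C : R, 0 <= C &
  forall x y, D x -> D y -> `|f x| <= C /\ `|f x - f y| <= C * `|x - y|.

Lemma bounded_lipschitz_cst D (c : R) : bounded_lipschitz D (fun=> c).
Proof. by exists `|c| => // x y _ _; rewrite subrr normr0 mulr_ge0. Qed.

Lemma bounded_lipschitzD D f g : bounded_lipschitz D f ->
  bounded_lipschitz D g -> bounded_lipschitz D (fun x => f x + g x).
Proof.
move=> [C C0 hC] [E E0 hE]; exists (C + E); first exact: addr_ge0.
move=> x y Dx Dy; have [f1 f2] := hC x y Dx Dy; have [g1 g2] := hE x y Dx Dy.
split; first exact: le_trans (ler_normD _ _) (lerD f1 g1).
rewrite opprD addrACA mulrDl.
exact: le_trans (ler_normD _ _) (lerD f2 g2).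
Qed.

Lemma bounded_lipschitzM D f g : bounded_lipschitz D f ->
  bounded_lipschitz D g -> bounded_lipschitz D (fun x => f x * g x).
Proof.
move=> [C C0 hC] [E E0 hE]; exists (C * E *+ 2).
  by rewrite mulrn_wge0 // mulr_ge0.
move=> x y Dx Dy; have [f1 f2] := hC x y Dx Dy; have [g1 g2] := hE x y Dx Dy.
have [_ g3] := hE y x Dy Dx; have [g4 _] := hE y y Dy Dy.
have CE : 0 <= C * E by exact: mulr_ge0.
split.
  rewrite normrM; apply: (le_trans (ler_pM _ _ f1 g1)) => //.
  by rewrite mulr2n lerDl.
have -> : f x * g x - f y * g y = f x * (g x - g y) + (f x - f y) * g y by ring.
apply: (le_trans (ler_normD _ _)); rewrite !normrM mulr2n [leRHS]mulrDl.
apply: lerD.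
  by rewrite -mulrA; apply: ler_pM.
by rewrite mulrAC; apply: ler_pM.
Qed.

Lemma bounded_lipschitz_sum D (I : Type) (r : seq I) (P : pred I)
    (F : I -> V -> R) :
  (forall i, P i -> bounded_lipschitz D (F i)) ->
  bounded_lipschitz D (fun x => \sum_(i <- r | P i) F i x).
Proof.
move=> hF; elim: r => [|i r IH].
  have -> : (fun x => \sum_(i <- [::] | P i) F i x) = (fun=> 0).
    by apply/funext => x; rewrite big_nil.
  exact: bounded_lipschitz_cst.
have -> : (fun x => \sum_(j <- i :: r | P j) F j x) =
    (fun x => (if P i then F i x else 0) + \sum_(j <- r | P j) F j x).
  by apply/funext => x; rewrite big_cons; case: ifP => //; rewrite add0r.
apply: bounded_lipschitzD IH.
by case Pi: (P i); [exact: hF | exact: bounded_lipschitz_cst].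
Qed.

Lemma bounded_lipschitz_prod D (I : Type) (r : seq I) (P : pred I)
    (F : I -> V -> R) :
  (forall i, P i -> bounded_lipschitz D (F i)) ->
  bounded_lipschitz D (fun x => \prod_(i <- r | P i) F i x).
Proof.
move=> hF; elim: r => [|i r IH].
  have -> : (fun x => \prod_(i <- [::] | P i) F i x) = (fun=> 1).
    by apply/funext => x; rewrite big_nil.
  exact: bounded_lipschitz_cst.
have -> : (fun x => \prod_(j <- i :: r | P j) F j x) =
    (fun x => (if P i then F i x else 1) * \prod_(j <- r | P j) F j x).
  by apply/funext => x; rewrite big_cons; case: ifP => //; rewrite mul1r.
apply: bounded_lipschitzM IH.
by case Pi: (P i); [exact: hF | exact: bounded_lipschitz_cst].
Qed.

(** The sum of the finitely many constants dominates each of them. The dependent index covers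
    families over all pairs of a player and an action. *)
Lemma bounded_lipschitz_uniform D (I : finType) (T : I -> finType)
    (F : forall i, T i -> V -> R) :
  (forall i a, bounded_lipschitz D (@F i a)) ->
  exists2 C : R, 0 <= C & forall i (a : T i) x y, D x -> D y ->
    `|F i a x| <= C /\ `|F i a x - F i a y| <= C * `|x - y|.
Proof.
move=> hF; pose c i a := projT1 (cid2 (hF i a)).
have c0 i a : 0 <= c i a by rewrite /c; case: cid2.
have sc0 i : 0 <= \sum_a c i a by exact: sumr_ge0.
exists (\sum_i \sum_a c i a) => [|i a x y Dx Dy]; first exact: sumr_ge0.
have ciaS : c i a <= \sum_i \sum_a c i a.
  rewrite (bigD1 i) //= (bigD1 a) //= -addrA lerDl.
  by apply: addr_ge0; apply: sumr_ge0.
have [Fx Fxy] : `|F i a x| <= c i a /\ `|F i a x - F i a y| <= c i a * `|x - y|.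
  by rewrite /c; case: cid2 => e /= _; exact.
split; first exact: le_trans ciaS.
by apply: (le_trans Fxy); rewrite ler_wpM2r.
Qed.

End BoundedLipschitz.

(** * Derivatives along lines *)

Section Segment.
Context {R : realType} {V : normedModType R}.

(** The difference quotients of [f] in direction [v] are those of the one-variable function
    [r |-> f (r *: v + x)]. *)
Lemma is_derive_along (f : V -> R) (x v : V) (s : R) :
  differentiable f (s *: v + x) ->
  is_derive s 1 (fun r : R => f (r *: v + x)) ('D_v f (s *: v + x)).
Proof.
move=> df; set g := fun r : R => _.
have E : (fun h : R => h^-1 *: ((f \o shift (s *: v + x)) (h *: v) - f (s *: v + x)))
   = (fun h : R => h^-1 *: ((g \o shift s) (h *: 1) - g s)).
  apply/funext => h; rewrite /g /= scalerDl addrA.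
  by congr (_ *: (f (_ *: v + _ + _) - _)); rewrite /GRing.scale /= mulr1.
have := @diff_derivable _ _ _ _ _ v df; rewrite /derivable E => dg.
by apply: DeriveDef => //; rewrite /derive E.
Qed.

Lemma segment_MVT (f : V -> R) (x y : V) :
  (forall s : R, 0 <= s <= 1 -> differentiable f (s *: (y - x) + x)) ->
  exists2 s : R, 0 <= s <= 1 & f y - f x = 'D_(y - x) f (s *: (y - x) + x).
Proof.
move=> df; pose g (r : R) := f (r *: (y - x) + x).
have dg (s : R) : 0 <= s <= 1 -> is_derive s 1 g ('D_(y - x) f (s *: (y - x) + x)).
  by move=> hs; apply/is_derive_along/df.
have [||s hs] := @MVT_segment R g (fun s => 'D_(y - x) f (s *: (y - x) + x)) 0 1 ler01.
- by move=> s; rewrite in_itv /= => /andP[/ltW s0 /ltW s1]; apply: dg; rewrite s0 s1.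
- apply: derivable_within_continuous => s; rewrite in_itv /= => hs.
  by have [] := dg s hs.
rewrite /g scale1r scale0r add0r subrK subr0 mulr1 => fE.
by exists s => //; move: hs; rewrite in_itv.
Qed.

(** Differentiability gives a two-sided limit, which can be read off the right-hand quotients.
    Inside a face, a move may be possible in one direction only. *)
Lemma derive_eq0_right (f : V -> R) (x v : V) (e : R) : 0 < e ->
  differentiable f x -> (forall s : R, 0 <= s <= e -> f (s *: v + x) = 0) ->
  'D_v f x = 0.
Proof.
move=> e0 df f0; have fx : f x = 0 by rewrite -(f0 0) ?scale0r ?add0r // lexx ltW.
have /cvg_dnbhs_at_right c :
    (fun h : R => h^-1 *: ((f \o shift x) (h *: v) - f x)) @ 0^' --> 'D_v f x.
  exact: (@diff_derivable _ _ _ _ _ v df).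
have c0 : (fun h : R => h^-1 *: ((f \o shift x) (h *: v) - f x)) @ 0^'+ --> (0 : R).
  apply: cvg_near_cst; near=> h.
  rewrite /= f0 ?fx ?subrr ?scaler0 //; apply/andP; split.
    by near: h; exact: nbhs_right_ge.
  by near: h; exact: nbhs_right_le.
exact: (cvg_unique _ c c0).
Unshelve. all: by end_near.
Qed.

End Segment.

(** * Coordinates, the sup norm, and sums over pure profiles *)

Section Coordinates.
Context {R : realType} {n : nat}.
Implicit Types (f : 'rV[R]_n -> R) (x v : 'rV[R]_n).

Lemma coord_le_norm x k : `|x ord0 k| <= `|x|.
Proof.
by rewrite [leRHS]/Num.norm /= mx_normrE; apply/bigmax_geP; right; exists (ord0, k).
Qed.

Lemma norm_le_coord x (c : R) : 0 <= c -> (forall k, `|x ord0 k| <= c) -> `|x| <= c.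
Proof.
move=> c0 xc; rewrite [leLHS]/Num.norm /= mx_normrE; apply/bigmax_leP; split=> //.
by move=> [i k] _ /=; rewrite ord1.
Qed.

Lemma derive_coord f x v : differentiable f x ->
  'D_v f x = \sum_k v ord0 k * 'D_(delta_mx ord0 k) f x.
Proof.
move=> df; rewrite deriveE // {1}[v]row_sum_delta linear_sum.
by apply: eq_bigr => k _; rewrite linearZ /= deriveE.
Qed.

End Coordinates.

(** Distributivity, obtained by transporting the sum to [fprod]. It yields the total mass and the
    marginals of product distributions. *)
Lemma sum_dffun_prod (R : comPzRingType) (I : finType) (T : I -> finType)
    (F : forall i, T i -> R) :
  \sum_(p : {dffun forall i, T i}) \prod_i F i (p i) = \prod_i \sum_a F i a.
Proof.
rewrite (reindex (@dffun_of_fprod _ T)) /=; last first.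
  by apply: onW_bij; exact: dffun_of_fprod_bij.
pose G i : {ffun T i -> R} := [ffun a => F i a].
transitivity (\sum_(t : fprod T) \prod_(i in I) G i (t i)).
  by apply: eq_bigr => t _; apply: eq_bigr => i _; rewrite !ffunE.
rewrite (big_fprod _ _ G).
rewrite -(bigA_distr_big_dep (tagged_with T) (fun i j => untag 0 (G i) j)).
apply: eq_bigr => i _.
apply: (etrans (esym (big_tag (fun i => G i) i))).
by apply: eq_bigr => a _; rewrite ffunE.
Qed.

(** * Mixed profiles and first-order expansions on them *)

Section Profiles.
Context {R : realType} {N : finType} {A : N -> finType}.
Local Notation space := (profile_space R A).
Local Notation pure := (pure_profile A).
Implicit Types (x y v : space) (f : space -> R).

Lemma coordinate_eq i j (a : A i) (b : A j) :
  (coordinate a == coordinate b) = (Tagged A a == Tagged A b).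
Proof. by rewrite /coordinate (inj_eq enum_rank_inj). Qed.

Lemma coordinate_enum_val (k : 'I_#|{: {i : N & A i}}|) :
  coordinate (tagged (enum_val k)) = k.
Proof. by rewrite /coordinate; case: (enum_val k) (enum_valK k). Qed.

Lemma sum_coordinates (F : 'I_#|{: {i : N & A i}}| -> R) :
  \sum_i \sum_(a : A i) F (coordinate a) = \sum_k F k.
Proof.
rewrite (sig_big_dep (fun=> true) (fun _ _ => true) (fun i a => F (coordinate a))) /=.
rewrite [RHS](reindex (@enum_rank {: {i : N & A i}})) /=; last first.
  by apply: onW_bij; exact: enum_rank_bij.
by apply: eq_bigr => -[i a].
Qed.

Lemma gradient_coordinate f x i (a : A i) :
  gradient f x ord0 (coordinate a) = partial f x a.
Proof. by rewrite mxE /coordinate enum_rankK. Qed.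

Lemma strategyDZ s v x i (a : A i) :
  strategy (s *: v + x) a = s * strategy v a + strategy x a.
Proof. by rewrite /strategy !mxE. Qed.

Lemma strategyB x y i (a : A i) :
  strategy (x - y) a = strategy x a - strategy y a.
Proof. by rewrite /strategy !mxE. Qed.

Lemma strategy_delta i j (a : A i) (b : A j) :
  strategy (delta_mx ord0 (coordinate a) : space) b =
  (Tagged A b == Tagged A a)%:R.
Proof. by rewrite /strategy mxE eqxx coordinate_eq. Qed.

Lemma strategy_le_norm x i (a : A i) : `|strategy x a| <= `|x|.
Proof. exact: coord_le_norm. Qed.

Lemma norm_le_strategy x (c : R) : 0 <= c ->
  (forall i (a : A i), `|strategy x a| <= c) -> `|x| <= c.
Proof.
move=> c0 xc; apply: norm_le_coord => // k.
by rewrite -(coordinate_enum_val k); exact: xc.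
Qed.

Lemma derive_strategy f x v : differentiable f x ->
  'D_v f x = \sum_i \sum_(a : A i) strategy v a * partial f x a.
Proof.
move=> df; rewrite derive_coord //.
exact/esym/(sum_coordinates (fun k => v ord0 k * 'D_(delta_mx ord0 k) f x)).
Qed.

Lemma strategy_ge0 x i (a : A i) : mixed_profile x -> 0 <= strategy x a.
Proof. by move=> /(_ i)[]. Qed.

Lemma sum_strategy x i : mixed_profile x -> \sum_(a : A i) strategy x a = 1.
Proof. by move=> /(_ i)[]. Qed.

Lemma strategy_le1 x i (a : A i) : mixed_profile x -> strategy x a <= 1.
Proof.
move=> xD; rewrite -(sum_strategy i xD) (bigD1 a) //= lerDl.
by apply: sumr_ge0 => b _; exact: strategy_ge0.
Qed.

Lemma mixed_profile_diameter x y :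
  mixed_profile x -> mixed_profile y -> `|x - y| <= 1.
Proof.
move=> xD yD; apply: norm_le_strategy => // i a; rewrite strategyB ler_norml.
have := (strategy_ge0 a xD, strategy_ge0 a yD, strategy_le1 a xD, strategy_le1 a yD).
by move=> [[[]]] *; apply/andP; split; lra.
Qed.

Lemma mixed_profile_segment x y (s : R) : mixed_profile x -> mixed_profile y ->
  0 <= s <= 1 -> mixed_profile (s *: (y - x) + x).
Proof.
move=> xD yD /andP[s0 s1] i; split=> [a|].
  rewrite strategyDZ strategyB.
  have -> : s * (strategy y a - strategy x a) + strategy x a =
    s * strategy y a + (1 - s) * strategy x a by ring.
  by rewrite addr_ge0 // mulr_ge0 ?strategy_ge0 // subr_ge0.
under eq_bigr => a _ do rewrite strategyDZ strategyB.
by rewrite big_split /= -mulr_sumr sumrB !sum_strategy // subrr mulr0 add0r.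
Qed.

(** Mixed profiles are within distance 1 of each other, so the value at a base point plus [k] bounds
    [f]; without a base point the claim is vacuous. *)
Lemma bounded_lipschitz_of_lipschitz f (k : R) : 0 <= k ->
  (forall x y, mixed_profile x -> mixed_profile y ->
     `|f x - f y| <= k * `|x - y|) ->
  bounded_lipschitz mixed_profile f.
Proof.
move=> k0 fk; have [[z zD]|nD] := pselect (exists z : space, mixed_profile z); last first.
  by exists 0 => // x y xD; case: nD; exists x.
exists (`|f z| + k); first by rewrite addr_ge0.
move=> x y xD yD; split; last first.
  by apply: (le_trans (fk _ _ xD yD)); rewrite ler_wpM2r // lerDr.
rewrite -[f x](subrK (f z)) addrC (le_trans (ler_normD _ _)) // lerD2l.
apply: (le_trans (fk _ _ xD zD)).
by rewrite ler_piMr // mixed_profile_diameter.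
Qed.

Lemma bounded_lipschitz_strategy i (a : A i) :
  bounded_lipschitz mixed_profile (fun x => strategy x a).
Proof.
apply: (@bounded_lipschitz_of_lipschitz _ 1) => // x y _ _.
by rewrite mul1r -strategyB strategy_le_norm.
Qed.

Lemma bounded_lipschitz_prob_some (B : forall i, {set A i}) :
  bounded_lipschitz mixed_profile (fun x => prob_some x B).
Proof.
apply: bounded_lipschitz_sum => p _; apply: bounded_lipschitzM.
  by apply: bounded_lipschitz_prod => i _; exact: bounded_lipschitz_strategy.
exact: bounded_lipschitz_cst.
Qed.

Lemma bounded_lipschitz_partial f i (a : A i) : lipschitz_differentiable f ->
  bounded_lipschitz mixed_profile (fun x => partial f x a).
Proof.
move=> [_ [k fk]].
apply: (@bounded_lipschitz_of_lipschitz _ `|k|) => // x y xD yD.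
rewrite -!gradient_coordinate.
have -> : gradient f x ord0 (coordinate a) - gradient f y ord0 (coordinate a) =
  strategy (gradient f x - gradient f y) a by rewrite strategyB.
apply: (le_trans (strategy_le_norm _ _)); apply: (le_trans (fk (x, y) _)) => //.
by rewrite ler_wpM2r // ler_norm.
Qed.

Lemma lipschitz_differentiable_at f x :
  lipschitz_differentiable f -> mixed_profile x -> differentiable f x.
Proof. by move=> [[U [_ DU fU]] _] /DU /fU[]. Qed.

(** The distance bounds allow Lipschitz partial derivatives to be moved from the intermediate point
    to an endpoint. *)
Lemma mixed_profile_MVT f x y : lipschitz_differentiable f ->
  mixed_profile x -> mixed_profile y ->
  exists2 z, [/\ mixed_profile z, `|z - x| <= `|y - x| & `|z - y| <= `|y - x|] &
    f y - f x = \sum_i \sum_(a : A i) (strategy y a - strategy x a) * partial f z a.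
Proof.
move=> fl xD yD; have [s hs|s hs ->] := @segment_MVT _ _ f x y.
  exact/lipschitz_differentiable_at/mixed_profile_segment.
have zD := mixed_profile_segment xD yD hs; case/andP: hs => s0 s1.
exists (s *: (y - x) + x); first split => //.
- by rewrite addrK normrZ ger0_norm // ler_piMl.
- have -> : s *: (y - x) + x - y = (s - 1) *: (y - x).
    by rewrite scalerBl scale1r opprB addrA addrAC.
  by rewrite normrZ distrC ger0_norm ?subr_ge0 // ler_piMl // gerBl.
rewrite derive_strategy; last exact: lipschitz_differentiable_at.
by apply: eq_bigr => i _; apply: eq_bigr => a _; rewrite strategyB.
Qed.

Lemma bounded_lipschitz_differentiable f : lipschitz_differentiable f ->
  bounded_lipschitz mixed_profile f.
Proof.
move=> fl; have [C C0 fC] :=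
  bounded_lipschitz_uniform (fun i (a : A i) => bounded_lipschitz_partial a fl).
apply: (@bounded_lipschitz_of_lipschitz _ (\sum_i \sum_(a : A i) C)).
  by apply: sumr_ge0 => i _; apply: sumr_ge0.
move=> x y xD yD; have [z [zD _ _] ->] := mixed_profile_MVT fl yD xD.
rewrite mulr_suml; apply: (le_trans (ler_norm_sum _ _ _)); apply: ler_sum => i _.
rewrite mulr_suml; apply: (le_trans (ler_norm_sum _ _ _)); apply: ler_sum => a _.
rewrite normrM mulrC; apply: ler_pM => //; last first.
  by rewrite -strategyB strategy_le_norm.
by have [] := fC i a z z zD zD.
Qed.

(* The gradient is taken at the endpoint [y], where the projection step makes
   tangentiality usable. *)
Lemma descent_bound f : lipschitz_differentiable f ->
  exists2 C : R, 0 <= C & forall x y, mixed_profile x -> mixed_profile y ->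
    \sum_i \sum_(a : A i) partial f y a * (strategy y a - strategy x a)
      - C * `|y - x| ^+ 2 <= f y - f x.
Proof.
move=> fl; have [C C0 fC] :=
  bounded_lipschitz_uniform (fun i (a : A i) => bounded_lipschitz_partial a fl).
exists (\sum_i \sum_(a : A i) C).
  by apply: sumr_ge0 => i _; apply: sumr_ge0.
move=> x y xD yD; have [z [zD _ zy] ->] := mixed_profile_MVT fl xD yD.
rewrite lerBlDr -lerBlDl -sumrB mulr_suml; apply: ler_sum => i _.
rewrite -sumrB mulr_suml; apply: ler_sum => a _.
(* Moving from [z] to [y] changes a partial derivative by a multiple of the norm of [y - x], and
   this multiplies a coordinate of [y - x]: the error is quadratic. *)
have -> : partial f y a * (strategy y a - strategy x a)
    - (strategy y a - strategy x a) * partial f z a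
  = (partial f y a - partial f z a) * strategy (y - x) a by rewrite strategyB; ring.
apply: (le_trans (ler_norm _)); rewrite normrM expr2 mulrA.
apply: ler_pM => //; last exact: strategy_le_norm.
have [_ fyz] := fC i a y z yD zD.
by apply: (le_trans fyz); rewrite distrC ler_wpM2l.
Qed.

End Profiles.

(** * Probabilities of pure profiles and gradients of utilities *)

Section Utilities.
Context {R : realType} {N : finType} {A : N -> finType}.
Local Notation space := (profile_space R A).
Local Notation pure := (pure_profile A).
Implicit Types (x y : space) (v : pure -> R) (B : forall i, {set A i}).

Lemma pure_prob_ge0 x (p : pure) : mixed_profile x -> 0 <= pure_prob x p.
Proof. by move=> xD; apply: prodr_ge0 => i _; exact: strategy_ge0. Qed.

Lemma sum_pure_prob x : mixed_profile x -> \sum_(p : pure) pure_prob x p = 1.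
Proof.
move=> xD; rewrite (sum_dffun_prod (fun i (a : A i) => strategy x a)).
by apply: big1 => i _; exact: sum_strategy.
Qed.

Lemma prob_some_ge0 x B : mixed_profile x -> 0 <= prob_some x B.
Proof.
by move=> xD; apply: sumr_ge0 => p _; rewrite mulr_ge0 ?pure_prob_ge0.
Qed.

Lemma prob_some_le1 x B : mixed_profile x -> prob_some x B <= 1.
Proof.
move=> xD; rewrite -(sum_pure_prob xD); apply: ler_sum => p _.
by rewrite ler_piMr ?pure_prob_ge0 // lern1 leq_b1.
Qed.

Lemma prob_some0 x B : (forall i, B i = finset.set0) -> prob_some x B = 0.
Proof.
move=> B0; apply: big1 => p _.
by case: existsP => [[i]|_]; [rewrite B0 inE | rewrite mulr0].
Qed.

Lemma prob_someU x B C : mixed_profile x ->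
  prob_some x (fun i => B i :|: C i)%SET <= prob_some x B + prob_some x C.
Proof.
move=> xD; rewrite -big_split; apply: ler_sum => p _ /=.
rewrite -mulrDr ler_wpM2l ?pure_prob_ge0 // -natrD ler_nat.
case: existsP => // -[i]; rewrite inE => /orP[pB|pC].
  by rewrite (_ : [exists i, p i \in B i] = true) ?leq_addr //; apply/existsP; exists i.
by rewrite (_ : [exists i, p i \in C i] = true) ?leq_addl //; apply/existsP; exists i.
Qed.

Lemma sum_strategy_le_prob_some x B i : mixed_profile x ->
  \sum_(a in B i) strategy x a <= prob_some x B.
Proof.
(* The indicator acts on player [i] alone; the other factors sum to 1, so the marginal mass is a
   product of sums that expands over pure profiles. *)
move=> xD; pose w j (a : A j) : R := strategy x a * ((j == i) ==> (a \in B j))%:R.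
have -> : \sum_(a in B i) strategy x a = \prod_j \sum_a w j a.
  rewrite (bigD1 i) //= [X in _ * X]big1 ?mulr1 => [|j ji].
    rewrite big_mkcond /=; apply: eq_bigr => a _.
    by rewrite /w eqxx /=; case: (a \in B i); rewrite ?mulr1 ?mulr0.
  rewrite -(sum_strategy j xD); apply: eq_bigr => a _.
  by rewrite /w (negbTE ji) mulr1.
rewrite -sum_dffun_prod; apply: ler_sum => p _.
rewrite big_split /= ler_wpM2l ?pure_prob_ge0 //.
have [piB|piB] := boolP (p i \in B i).
  rewrite (_ : [exists i, p i \in B i] = true); last by apply/existsP; exists i.
  by apply: prodr_ile1 => j _; rewrite ler0n lern1 leq_b1.
by rewrite (bigD1 i) //= eqxx (negbTE piB) mul0r.
Qed.

(** The coefficient of the coordinate [(i, a)] in the multilinear extension of [v]: at a mixed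
    profile, the expected value of [v] when [i] deviates to [a]. *)
Definition deviation_payoff v x i (a : A i) : R :=
  \sum_(p : pure | p i == a) (\prod_(j | j != i) strategy x (p j)) * v p.

Lemma pure_prob_shift x (s : R) i (a : A i) (p : pure) :
  pure_prob (s *: delta_mx ord0 (coordinate a) + x) p =
  pure_prob x p + s * ((p i == a)%:R * \prod_(j | j != i) strategy x (p j)).
Proof.
rewrite /pure_prob (bigD1 i) //= [in RHS](bigD1 i) //= strategyDZ strategy_delta.
rewrite eq_Tagged /=.
rewrite [X in _ * X = _](eq_bigr (fun j => strategy x (p j))); first by ring.
move=> j ji; rewrite strategyDZ strategy_delta; case: eqP => [E|_].
  by move: ji; rewrite (congr1 tag E : j = i) eqxx.
by rewrite mulr0 add0r.
Qed.

(** A pure profile uses one action per player, so the extension is affine in each coordinate and its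
    difference quotients are constant. *)
Lemma partial_mixed_utility v x i (a : A i) :
  partial (mixed_utility v) x a = deviation_payoff v x a.
Proof.
apply: cvg_lim => //; apply: cvg_near_cst; near=> s.
have s0 : s != 0 by near: s; exact: nbhs_dnbhs_neq.
have -> : ((mixed_utility v \o shift x) (s *: delta_mx ord0 (coordinate a))
    - mixed_utility v x) = s *: deviation_payoff v x a.
  rewrite /= /mixed_utility -sumrB /deviation_payoff [in RHS]big_mkcond scaler_sumr.
  apply: eq_bigr => p _; rewrite pure_prob_shift mulrDl addrAC subrr add0r.
  by rewrite /GRing.scale /=; case: eqP => _; rewrite ?mul0r ?mul1r ?mulr0 ?mulrA ?mul0r.
by rewrite [LHS]scalerA mulVf // [LHS]scale1r.
Unshelve. all: by end_near.
Qed.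

Lemma bounded_lipschitz_partial_utility v i (a : A i) :
  bounded_lipschitz mixed_profile (fun x => partial (mixed_utility v) x a).
Proof.
have -> : (fun x => partial (mixed_utility v) x a) =
    (fun x => deviation_payoff v x a).
  by apply/funext => x; exact: partial_mixed_utility.
apply: bounded_lipschitz_sum => p _; apply: bounded_lipschitzM.
  by apply: bounded_lipschitz_prod => j _; exact: bounded_lipschitz_strategy.
exact: bounded_lipschitz_cst.
Qed.

End Utilities.

(** * Faces and the corresponding subgames *)

Section Faces.
Context {R : realType} {N : finType} {A : N -> finType}.
Local Notation space := (profile_space R A).
Local Notation pure := (pure_profile A).
Variable B : forall i, {set A i}.
Implicit Types (x y : space) (v : pure -> R).

Definition include_pure (p : pure_profile (subaction B)) : pure :=
  [ffun j => val (p j)].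

Lemma include_pure_inj : injective include_pure.
Proof.
move=> p q /ffunP pq; apply/ffunP => j; apply: val_inj.
by have := pq j; rewrite !ffunE.
Qed.

Lemma sum_include_pure (G : pure -> R) :
  (forall (p : pure) i, p i \notin B i -> G p = 0) ->
  \sum_p G p = \sum_p G (include_pure p).
Proof.
move=> G0; rewrite (bigID (fun p => p \in
  [set include_pure q | q in [set: pure_profile (subaction B)]]%SET)) /=.
rewrite [X in _ + X]big1 ?addr0 => [|p /imsetP np].
  rewrite big_imset /= => [|p q _ _]; last exact: include_pure_inj.
  by apply: eq_bigl => q; rewrite finset.in_setT.
have [/forallP pB|/forallPn[i]] := boolP [forall i, p i \in B i]; last exact: G0.
case: np; exists [ffun j => (exist _ (p j) (pB j) : subaction B j)] => //.
by apply/ffunP => j; rewrite !ffunE.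
Qed.

Lemma strategy_to_subgame x i (a : subaction B i) :
  strategy (to_subgame B x) a = strategy x (val a).
Proof. by rewrite [LHS]mxE /coordinate enum_rankK. Qed.

Lemma pure_prob_include x p : pure_prob x (include_pure p) =
  pure_prob (to_subgame B x) p.
Proof. by apply: eq_bigr => j _; rewrite ffunE strategy_to_subgame. Qed.

Lemma pure_prob_face x (p : pure) i :
  face B x -> p i \notin B i -> pure_prob x p = 0.
Proof. by move=> [_ x0] pi; rewrite /pure_prob (bigD1 i) //= x0 ?mul0r. Qed.

Lemma sum_face i (G : A i -> R) : (forall a, a \notin B i -> G a = 0) ->
  \sum_(a : A i) G a = \sum_(a : subaction B i) G (val a).
Proof.
move=> G0; rewrite (bigID (mem (B i))) /= [X in _ + X]big1 ?addr0 //.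
by rewrite [LHS]big_sub /=.
Qed.

Lemma to_subgame_mixed x : face B x -> mixed_profile (to_subgame B x).
Proof.
move=> [xD x0] i; split=> [a|]; first by rewrite strategy_to_subgame strategy_ge0.
rewrite -(sum_strategy i xD) [RHS]sum_face => [|a /x0 //].
by apply: eq_bigr => a _; rewrite strategy_to_subgame.
Qed.

Lemma prob_some_face x (C : forall i, {set A i}) : face B x ->
  prob_some (to_subgame B x) (subaction_set B C) = prob_some x C.
Proof.
move=> xF; rewrite [RHS]sum_include_pure => [|p i pi]; last first.
  by rewrite (pure_prob_face xF pi) mul0r.
apply: eq_bigr => p _; rewrite pure_prob_include; congr (_ * _%:R).
by congr nat_of_bool; apply: eq_existsb => i; rewrite ffunE inE.
Qed.

Lemma partial_subutility (u : N -> pure -> R) (k : N) x i (a : subaction B i) :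
  face B x ->
  partial (mixed_utility (subutility u k)) (to_subgame B x) a =
  partial (mixed_utility (u k)) x (val a).
Proof.
move=> [_ x0]; rewrite !partial_mixed_utility /deviation_payoff.
rewrite [RHS]big_mkcond [RHS]sum_include_pure => [|p j pj].
  rewrite [LHS]big_mkcond; apply: eq_bigr => p _; rewrite ffunE val_eqE.
  case: ifP => // _; congr (_ * _).
  by apply: eq_bigr => j _; rewrite ffunE strategy_to_subgame.
(* As [a] lies in [B i], a profile that plays [a] and leaves [B] does so at an opponent [j], whose
   factor is zero on the face. *)
case: eqP => // pia; have ji : j != i.
  by apply: contraNneq pj => ->; rewrite pia (valP a).
by rewrite (bigD1 j) //= x0 // !mul0r.
Qed.

End Faces.

(** * Directions that move mass between two actions *)

Section Exchange.
Context {R : realType} {N : finType} {A : N -> finType}.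
Local Notation space := (profile_space R A).
Implicit Types (x y v : space) (f : space -> R).

Lemma derive_exchange f x i (a c : A i) : differentiable f x ->
  'D_(delta_mx ord0 (coordinate a) - delta_mx ord0 (coordinate c)) f x =
  partial f x a - partial f x c.
Proof. by move=> df; rewrite deriveE // linearB /= /partial !deriveE. Qed.

Lemma sum_delta i j (a : A i) :
  \sum_(b : A j) (Tagged A b == Tagged A a)%:R = (j == i)%:R :> R.
Proof.
case: (eqVneq j i) a => [->|ji] a; last first.
  by rewrite big1 // => b _; case: eqP => // /(congr1 tag) /= /eqP; rewrite (negbTE ji).
rewrite (bigD1 a) //= eqxx big1 ?addr0 // => b ba.
by rewrite eq_Tagged /= (negbTE ba).
Qed.

End Exchange.

(** * Gradient of an extension at points of a face *)

Section FaceGradient.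
Context {R : realType} {N : finType} {A : N -> finType}.
Variable B : forall i, {set A i}.
Local Notation space := (profile_space R A).
Implicit Types (x y v : space) (f : space -> R).
Local Notation subspace := (profile_space R (subaction B)).

Lemma to_subgameDZ (s : R) v x :
  to_subgame B (s *: v + x) = s *: to_subgame B v + to_subgame B x.
Proof. by apply/rowP => k; rewrite !mxE strategyDZ. Qed.

Lemma to_subgame_exchange i (a c : subaction B i) :
  to_subgame B (delta_mx ord0 (coordinate (val a))
                - delta_mx ord0 (coordinate (val c))) =
  delta_mx ord0 (coordinate a) - delta_mx ord0 (coordinate c) :> subspace.
Proof.
apply/rowP => k; rewrite -(coordinate_enum_val k).
have E (j : N) (b : subaction B j) (d : subaction B i) :
    (Tagged A (val b) == Tagged A (val d)) =
    (Tagged (subaction B) b == Tagged (subaction B) d).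
  case: (eqVneq j i) b => [->|ji] b; first by rewrite !eq_Tagged /= val_eqE.
  apply/eqP/eqP => /(congr1 tag) /= /eqP; by rewrite (negbTE ji).
case: (enum_val k) => j b /=.
have S (z : subspace) : z ord0 (coordinate b) = strategy z b by [].
by rewrite !S strategy_to_subgame !strategyB !strategy_delta !E.
Qed.

(** Moving mass [s] from [c] to [a] keeps every total, and [c] has enough mass to give. *)
Lemma face_exchange x i (a c : A i) (s : R) : face B x ->
  a \in B i -> c \in B i -> 0 <= s <= strategy x c ->
  face B (s *: (delta_mx ord0 (coordinate a) - delta_mx ord0 (coordinate c)) + x).
Proof.
move=> [xD x0] aB cB /andP[s0 sc]; split=> [j|j b bB].
  split=> [b|].
    rewrite strategyDZ strategyB !strategy_delta.
    have xb := strategy_ge0 b xD.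
    have [bc|bc] := eqVneq (Tagged A b) (Tagged A c); last first.
      by rewrite subr0 addr_ge0 // mulr_ge0.
    have -> : strategy x b = strategy x c by rewrite /strategy /coordinate bc.
    by case: (_ == _) => /=; lra.
  under eq_bigr => b _ do rewrite strategyDZ strategyB !strategy_delta.
  by rewrite big_split /= -mulr_sumr sumrB !sum_delta subrr mulr0 add0r sum_strategy.
have D (d : A i) : d \in B i -> (Tagged A b == Tagged A d) = false.
  move=> dB; apply/eqP => /(congr1 (fun t : {i : N & A i} => tagged t \in B (tag t))).
  by rewrite /= dB (negbTE bB).
by rewrite strategyDZ strategyB !strategy_delta !D // subrr mulr0 add0r x0.
Qed.

(* Two functions that agree on the face share their derivatives only along
   directions that stay in the face; tangentiality pins down the remaining
   constant shift of each player's gradient. *)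
Lemma partial_face f (h : subspace -> R) x i (a : subaction B i) :
  lipschitz_differentiable f -> lipschitz_differentiable h ->
  tangential f -> tangential h ->
  (forall y, face B y -> f y = h (to_subgame B y)) ->
  (forall c : A i, c \notin B i -> partial f x c = 0) ->
  face B x -> partial f x (val a) = partial h (to_subgame B x) a.
Proof.
move=> fl hl ft ht fh f0 xF.
have [xD _] := xF; have xsD := to_subgame_mixed xF.
have df := lipschitz_differentiable_at fl xD.
have dh := lipschitz_differentiable_at hl xsD.
pose P (b : subaction B i) := partial f x (val b).
pose Q (b : subaction B i) := partial h (to_subgame B x) b.
(* An action [c] in the support can give mass to any [b], so the exchange stays in the face for a
   positive time. *)
have [c c0] : exists c : subaction B i, strategy (to_subgame B x) c != 0.
  apply: contrapT => H; have /eqP := sum_strategy i xsD.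
  rewrite big1 => [|c _]; first by rewrite eq_sym oner_eq0.
  by apply: contrapT => /eqP c0; case: H; exists c.
have {}c0 : 0 < strategy x (val c).
  by rewrite -(strategy_to_subgame x c) lt0r c0 strategy_ge0.
have PQ b : P b - P c = Q b - Q c.
  rewrite -(derive_exchange (val b) (val c) df) -(derive_exchange b c dh).
  rewrite -to_subgame_exchange; set w := delta_mx _ _ - _.
  have := @is_derive_along _ _ f x w 0; rewrite scale0r add0r => /(_ df) Df.
  have := @is_derive_along _ _ h (to_subgame B x) (to_subgame B w) 0.
  rewrite scale0r add0r => /(_ dh) Dh.
  apply/eqP; rewrite -subr_eq0; apply/eqP.
  (* Along the exchange segment [f] and [h] agree, so their difference has zero derivative from the
     right. *)
  have D := is_deriveB Df Dh; rewrite -(derive_val (is_derive := D)).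
  apply: (derive_eq0_right c0); first by apply/derivable1_diffP; case: D.
  move=> s hs; rewrite addr0 [s *: _]mulr1.
  rewrite -[LHS]/(f (s *: w + x) - h (s *: to_subgame B w + to_subgame B x)).
  rewrite -to_subgameDZ fh ?subrr //.
  by apply: face_exchange => //; exact: valP.
(* The partial derivatives outside [B] vanish, so tangentiality of [f] already gives a zero sum over
   the actions of the subgame. *)
have sP : \sum_b P b = 0.
  by rewrite -(sum_face f0); have [] := ft x xD i.
have [sQ _] := ht _ xsD i.
(* The shift [P c - Q c] is the same for all actions and sums to zero over a nonempty set. *)
have Pc : P c = Q c.
  have : \sum_(b : subaction B i) (P c - Q c) = 0.
    transitivity (\sum_b P b - \sum_b Q b); last by rewrite sP sQ subrr.
    rewrite -sumrB; apply: eq_bigr => b _.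
    have := PQ b; lra.
  rewrite sumr_const => /eqP; rewrite mulrn_eq0 => /orP[/eqP/card0_eq/(_ c)|].
    by rewrite inE.
  by rewrite subr_eq0 => /eqP.
by have := PQ a; rewrite Pc => /addIr.
Qed.

End FaceGradient.

(** * Gains off the face and weights across stages *)

Section Elimination.
Context {R : realType} {N : finType} {A : N -> finType}.
Local Notation space := (profile_space R A).
Local Notation pure := (pure_profile A).
Implicit Types (x y : space) (f : space -> R) (B C : forall i, {set A i}).

(** The mass that [i] puts outside [B i] moves to one chosen action of [B i]. No coordinate changes
    by more than this mass, which is at most the probability of leaving [B]. *)
Lemma face_retraction B x : (forall i, B i != finset.set0) -> mixed_profile x ->
  exists2 y, face B y & `|x - y| <= prob_some x (fun i => ~: B i)%SET.
Proof.
move=> B0 xD; pose b i : A i := projT1 (cid (set0Pn _ (B0 i))).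
have bB i : b i \in B i by rewrite /b; case: cid.
pose missing i := \sum_(a in ~: B i) strategy x a.
have missing0 i : 0 <= missing i.
  by apply: sumr_ge0 => a _; exact: strategy_ge0.
pose s i (a : A i) : R :=
  if a \in B i then strategy x a + (a == b i)%:R * missing i else 0.
pose y : space := \row_k s (tag (enum_val k)) (tagged (enum_val k)).
have ys i (a : A i) : strategy y a = s i a.
  by rewrite /strategy mxE /coordinate enum_rankK.
exists y; first split=> [i|i a aB].
- split=> [a|].
    rewrite ys /s; case: ifP => // _.
    by rewrite addr_ge0 ?strategy_ge0 // mulr_ge0.
  under eq_bigr => a _ do rewrite ys.
  rewrite /s -big_mkcond big_split /= [X in _ + X](bigD1 (b i)) //= eqxx.
  rewrite [X in _ + (_ + X)]big1 => [|a /andP[_ /negbTE->]]; last by rewrite mul0r.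
  rewrite addr0 mul1r -(sum_strategy i xD) [RHS](bigID (mem (B i))) /=.
  by congr (_ + _); apply: eq_bigl => a; rewrite inE.
- by rewrite ys /s (negbTE aB).
apply: norm_le_strategy => [|i a]; first exact: prob_some_ge0.
rewrite strategyB ys /s; apply: (le_trans _ (sum_strategy_le_prob_some _ i xD)).
rewrite -/(missing i); case: ifPn => [aB|aB].
  rewrite opprD addNKr normrN.
  by case: eqP; rewrite ?mul1r ?mul0r ?normr0 ?ger0_norm.
rewrite subr0 ger0_norm ?strategy_ge0 // /missing (bigD1 a) ?inE //= lerDl.
by apply: sumr_ge0 => c _; exact: strategy_ge0.
Qed.

(** The inequality is carried from a nearby face point to [x]; [F] and [G] each contribute their
    Lipschitz constant. *)
Lemma bounded_lipschitz_le_of_face B (F G : space -> R) :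
  (forall i, B i != finset.set0) ->
  bounded_lipschitz mixed_profile F -> bounded_lipschitz mixed_profile G ->
  (forall y, face B y -> G y <= F y) ->
  exists2 c : R, 0 <= c & forall x, mixed_profile x ->
    G x - c * prob_some x (fun i => ~: B i)%SET <= F x.
Proof.
move=> B0 [c c0 hF] [e e0 hG] GF; exists (c + e); first exact: addr_ge0.
move=> x xD; have [y yF xy] := face_retraction B0 xD.
have [yD _] := yF.
have [_ Fxy] := hF y x yD xD; have [_ Gxy] := hG x y xD yD.
have Fle : F y - F x <= c * prob_some x (fun i => ~: B i)%SET.
  apply: (le_trans (ler_norm _)); apply: (le_trans Fxy).
  by rewrite distrC ler_wpM2l.
have Gle : G x - G y <= e * prob_some x (fun i => ~: B i)%SET.
  apply: (le_trans (ler_norm _)); apply: (le_trans Gxy).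
  by rewrite ler_wpM2l.
have := GF y yF; rewrite mulrDl; lra.
Qed.

(** First-order rate of change of [f] when all players follow their own utility gradients. *)
Definition gain (u : N -> pure -> R) f x : R :=
  \sum_i \sum_(a : A i) partial f x a * partial (mixed_utility (u i)) x a.

Lemma bounded_lipschitz_gain (u : N -> pure -> R) f :
  lipschitz_differentiable f -> bounded_lipschitz mixed_profile (gain u f).
Proof.
move=> fl; apply: bounded_lipschitz_sum => i _.
apply: bounded_lipschitz_sum => a _; apply: bounded_lipschitzM.
  exact: bounded_lipschitz_partial.
exact: bounded_lipschitz_partial_utility.
Qed.

Lemma elimination_bound (u : N -> pure -> R) f B C
    (h : profile_space R (subaction B) -> R) :
  (forall i, B i != finset.set0) ->
  lipschitz_differentiable f -> tangential f ->
  (forall y, face B y -> f y = h (to_subgame B y)) ->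
  (forall i (a : A i), a \notin B i -> forall y, face B y -> partial f y a = 0) ->
  eliminated_via_potential (subutility u) (subaction_set B C) h ->
  exists2 c : R, 0 <= c & forall x, mixed_profile x ->
    prob_some x (fun i => ~: (B i :\: C i))%SET
      - c * prob_some x (fun i => ~: B i)%SET <= gain u f x.
Proof.
move=> B0 fl ft fh f0 [_ _ hl ht hgain].
have [|c c0 hc] := bounded_lipschitz_le_of_face B0 (bounded_lipschitz_gain u fl)
  (bounded_lipschitz_prob_some C).
  move=> y yF; rewrite -(prob_some_face _ yF).
  apply: (le_trans (hgain _ (to_subgame_mixed yF))).
  apply: ler_sum => i _; rewrite [leRHS](sum_face (B := B)).
    rewrite le_eqVlt; apply/orP; left; apply/eqP; apply: eq_bigr => a _.
    rewrite partial_subutility // (partial_face a fl hl) // => d dB.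
    exact: f0.
  by move=> a aB; rewrite f0 ?mul0r.
(* The extra 1 pays for the union bound: an action outside [B i :\: C i] is outside [B i] or lies in
   [C i]. *)
exists (c + 1) => [|x xD]; first by rewrite addr_ge0.
have := hc x xD; have := prob_someU (fun i => ~: B i)%SET C xD.
have -> : (fun i => ~: (B i :\: C i))%SET = (fun i => ~: B i :|: C i)%SET.
  apply/functional_extensionality_dep => i.
  by rewrite finset.setDE finset.setCI finset.setCK.
rewrite mulrDl mul1r; lra.
Qed.

End Elimination.

(** The weights are fixed before [p] and [F], hence serve all profiles at once. A new stage gets
    weight 1 and multiplies earlier weights by [c K + 1], so that the earlier part covers the loss
    [c K * p K]; the 1 keeps weights positive when [c K] is zero. *)
Lemma geometric_weights (R : realType) (c : nat -> R) (K : nat) :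
  (forall l, (l < K)%N -> 0 <= c l) ->
  exists2 e : nat -> R, (forall l, (l < K)%N -> 0 < e l) &
    forall p F : nat -> R, p 0%N = 0 -> (forall l, 0 <= p l) ->
      (forall l, (l < K)%N -> p l.+1 - c l * p l <= F l) ->
      p K <= \sum_(l < K) e l * F l.
Proof.
elim: K => [|K IH] c0.
  by exists (fun=> 1) => // p F p0 _ _; rewrite big_ord0 p0.
have [l lK|e e0 he] := IH; first exact/c0/ltnW.
have cK := c0 K (ltnSn K); have cK1 : 0 < c K + 1 by lra.
exists (fun l => if (l < K)%N then (c K + 1) * e l else 1) => [l _|p F p0 pge pF].
  by case: ifP => // /e0 el; rewrite mulr_gt0.
rewrite big_ord_recr /= ltnn mul1r.
under eq_bigr => l _ do rewrite ltn_ord -mulrA.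
rewrite -mulr_sumr.
have H : p K <= \sum_(l < K) e l * F l.
  by apply: he => // l lK; exact/pF/ltnW.
have := pF K (ltnSn K); have := pge K.
have := ler_wpM2l (ltW cK1) H; lra.
Qed.

(** * Projected gradient ascent *)

Section GradientAscent.
Context {R : realType}.

(** Were the pairing positive, a small move from [z] along [v] would stay in the simplex and come
    strictly closer to [y]. *)
Lemma projection_tangent (S : finType) (y z v : S -> R) :
  is_projection (simplex R S) y z ->
  \sum_a v a = 0 -> (forall a, z a = 0 -> 0 <= v a) ->
  \sum_a (y a - z a) * v a <= 0.
Proof.
move=> [[z0 z1] zmin] v0 vge; rewrite leNgt; apply/negP => c0.
set c := \sum_a _ in c0; pose q := \sum_a v a ^+ 2.
suff [s [s0 sv sq]] : exists s : R,
    [/\ 0 < s, forall a, 0 <= z a + s * v a & s * q < c].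
  have wS : simplex R S (fun a => z a + s * v a).
    by split=> //; rewrite big_split /= -mulr_sumr v0 mulr0 addr0.
  have := zmin _ wS; rewrite ler_sqrt; last by apply: sumr_ge0 => a _; rewrite sqr_ge0.
  (* The squared distance drops by [s * (2 * c - s * q)], which is positive as [s * q < c]. *)
  have -> : \sum_a (y a - (z a + s * v a)) ^+ 2 =
      \sum_a (y a - z a) ^+ 2 - s * (2 * c - s * q).
    rewrite /c /q mulrBr !mulr_sumr -!sumrB; apply: eq_bigr => a _; ring.
  rewrite lerDl oppr_ge0 pmulr_rle0 //; lra.
have q0 : 0 <= q by apply: sumr_ge0 => a _; rewrite sqr_ge0.
have q1 : 0 < 1 + q by rewrite ltr_wpDr.
have : \forall s \near 0^'+, [/\ 0 < s, forall a, 0 <= z a + s * v a & s * q < c].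
  near=> s; split; first by near: s; exact: nbhs_right_gt.
    near: s; apply: filter_forall => a; have [za|za] := eqVneq (z a) 0.
      near=> s; rewrite za add0r mulr_ge0 ?vge //.
    have {}za : 0 < z a by rewrite lt0r za z0.
    have v1 : 0 < 1 + `|v a| by rewrite ltr_wpDr.
    near=> s.
    have s0 : 0 < s by near: s; exact: nbhs_right_gt.
    have : s <= z a / (1 + `|v a|) by near: s; apply: nbhs_right_le; exact: divr_gt0.
    rewrite ler_pdivlMr // mulrDr mulr1 => sz.
    have := ler_norm (- (s * v a)); rewrite normrN normrM (gtr0_norm s0); lra.
  have s0 : 0 < s by near: s; exact: nbhs_right_gt.
  have : s < c / (1 + q) by near: s; apply: nbhs_right_lt; exact: divr_gt0.
  rewrite ltr_pdivlMr // mulrDr mulr1; lra.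
by move=> /filter_ex[s]; exists s.
Unshelve. all: by end_near.
Qed.

Context {N : finType} {A : N -> finType}.
Local Notation space := (profile_space R A).
Local Notation pure := (pure_profile A).
Implicit Types (x y : space) (f : space -> R) (u : N -> pure -> R).

Lemma gradient_ascent_step_mixed u (s : R) x y :
  gradient_ascent_step u s x y -> mixed_profile y.
Proof. by move=> xy i; have [] := xy i. Qed.

Lemma gradient_ascent_step_norm u :
  exists2 L : R, 0 <= L & forall (s : R) x y, 0 < s -> mixed_profile x ->
    gradient_ascent_step u s x y -> `|y - x| <= s * L.
Proof.
have [C C0 uC] := bounded_lipschitz_uniform
  (fun i (a : A i) => bounded_lipschitz_partial_utility (u i) a).
pose Q := \sum_(i : N) \sum_(a : A i) C ^+ 2.
have Q0 : 0 <= Q.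
  by apply: sumr_ge0 => i _; apply: sumr_ge0 => a _; rewrite sqr_ge0.
(* [1 + Q] stands in for the square root of [Q], since [Q <= (1 + Q) ^+ 2]. *)
exists (1 + Q) => [|s x y s0 xD xy]; first by rewrite addr_ge0.
have yD := gradient_ascent_step_mixed xy.
have L0 : 0 <= s * (1 + Q) by rewrite mulr_ge0 ?addr_ge0 // ltW.
apply: norm_le_strategy => // i a; rewrite strategyB.
pose g (b : A i) := partial (mixed_utility (u i)) x b.
pose d (b : A i) := strategy y b - strategy x b.
have dg : \sum_b d b ^+ 2 <= s ^+ 2 * \sum_b g b ^+ 2.
  (* The direction from [y] back to the feasible point [x] is tangent at [y]. *)
  have := @projection_tangent _ _ _ (fun b => strategy x b - strategy y b) (xy i).
  rewrite sumrB !sum_strategy // subrr => /(_ erefl) H.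
  have {}H : \sum_b (strategy x b + s * g b - strategy y b) *
      (strategy x b - strategy y b) <= 0.
    by apply: H => b ->; rewrite subr0 strategy_ge0.
  (* AM-GM: [s g d <= (s^2 g^2 + d^2) / 2] *)
  have : \sum_b (d b ^+ 2 - s ^+ 2 * g b ^+ 2) <= 2 * \sum_b
     (strategy x b + s * g b - strategy y b) * (strategy x b - strategy y b).
    rewrite mulr_sumr; apply: ler_sum => b _; rewrite /d -subr_ge0.
    have := sqr_ge0 (s * g b - (strategy y b - strategy x b)); lra.
  rewrite sumrB -mulr_sumr; lra.
have gQ : \sum_b g b ^+ 2 <= Q.
  rewrite /Q (bigD1 i) //= -[leLHS]addr0; apply: lerD; last first.
    by apply: sumr_ge0 => j _; apply: sumr_ge0 => b _; rewrite sqr_ge0.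
  apply: ler_sum => b _; rewrite -(real_normK (num_real (g b))) lerXn2r ?nnegrE //.
  by have [] := uC i b x x xD xD.
have da : d a ^+ 2 <= \sum_b d b ^+ 2.
  by rewrite (bigD1 a) //= lerDl sumr_ge0 // => b _; rewrite sqr_ge0.
rewrite -(ler_sqr (normr_ge0 _) L0) ?nnegrE // real_normK ?num_real //.
apply: (le_trans da); apply: (le_trans dg); rewrite exprMn.
rewrite ler_wpM2l ?sqr_ge0 //; nra.
Qed.

(** Two errors of order [s ^+ 2] arise: the quadratic term of [descent_bound], and the change of the
    gradient of [f] from [x] to [y]. *)
Lemma gradient_ascent_step_gain u f : lipschitz_differentiable f -> tangential f ->
  exists2 C : R, 0 <= C & forall (s : R) x y, 0 < s -> mixed_profile x ->
    gradient_ascent_step u s x y -> s * gain u f x - C * s ^+ 2 <= f y - f x.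
Proof.
move=> fl ft.
have [D D0 fD] := descent_bound fl.
have [L L0 xL] := gradient_ascent_step_norm u.
have [F F0 fF] := bounded_lipschitz_uniform
  (fun i (a : A i) => bounded_lipschitz_partial a fl).
have [G G0 uG] := bounded_lipschitz_uniform
  (fun i (a : A i) => bounded_lipschitz_partial_utility (u i) a).
pose n : R := \sum_(i : N) \sum_(a : A i) 1.
have n0 : 0 <= n by apply: sumr_ge0 => i _; apply: sumr_ge0.
exists (D * L ^+ 2 + F * L * G * n) => [|s x y s0 xD xy].
  by rewrite addr_ge0 ?mulr_ge0 // exprn_ge0.
have yD := gradient_ascent_step_mixed xy.
have yx := xL s x y s0 xD xy.
pose g i (a : A i) := partial (mixed_utility (u i)) x a.
(* The gradient of [f] at [y] is a tangent direction there, so it pairs nonpositively with the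
   projection error. *)
have tang : s * (\sum_i \sum_(a : A i) partial f y a * g i a) <=
    \sum_i \sum_(a : A i) partial f y a * (strategy y a - strategy x a).
  rewrite mulr_sumr; apply: ler_sum => i _; rewrite mulr_sumr -subr_le0 -sumrB.
  have [f0 fge] := ft y yD i; apply: le_trans (projection_tangent (xy i) f0 fge).
  by apply: ler_sum => a _; rewrite /g le_eqVlt; apply/orP; left; apply/eqP; ring.
have swap : gain u f x - s * (F * L * G * n) <=
    \sum_i \sum_(a : A i) partial f y a * g i a.
  rewrite lerBlDr -lerBlDl -sumrB /n 2!mulr_sumr; apply: ler_sum => i _.
  rewrite -sumrB 2!mulr_sumr; apply: ler_sum => a _.
  rewrite -mulrBl mulr1; apply: (le_trans (ler_norm _)); rewrite normrM.
  have [_ h1] := fF i a x y xD yD; have [h2 _] := uG i a x x xD xD.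
  have h3 : `|partial f x a - partial f y a| <= s * F * L.
    by apply: (le_trans h1); rewrite distrC -mulrA mulrCA ler_wpM2l.
  by rewrite !mulrA; apply: ler_pM.
have sq : `|y - x| ^+ 2 <= s ^+ 2 * L ^+ 2.
  by rewrite -exprMn lerXn2r // nnegrE ?normr_ge0 // mulr_ge0 // ltW.
have := fD x y xD yD.
have := ler_wpM2l D0 sq; have := ler_wpM2l (ltW s0) swap.
rewrite mulrBr; lra.
Qed.

(** The new increment turns the bound into [H n.+2 / c n.+1]; passing to the smaller [c n.+2] only
    enlarges it because [H] is nonnegative. *)
Lemma abel_bound (c H : nat -> R) (n : nat) :
  (forall t, (1 <= t <= n.+1)%N -> 0 <= H t) ->
  (forall t, (1 <= t <= n.+1)%N -> 0 < c t) ->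
  (forall t, (1 <= t <= n)%N -> c t.+1 <= c t) ->
  \sum_(1 <= t < n.+1) (H t.+1 - H t) / c t <= H n.+1 / c n.+1.
Proof.
elim: n => [|n IH] H0 c0 cd.
  by rewrite big_geq // divr_ge0 ?H0 // ltW // c0.
have c1 : 0 < c n.+1 by apply: c0; rewrite /= leqnSn.
have c2 : 0 < c n.+2 by apply: c0; rewrite leqnn.
have cc : c n.+2 <= c n.+1 by apply: cd; rewrite leqnn.
have IHn : \sum_(1 <= t < n.+1) (H t.+1 - H t) / c t <= H n.+1 / c n.+1.
  by apply: IH => t /andP[t1 tn]; [apply: H0 | apply: c0 | apply: cd]; rewrite t1 ltnW.
rewrite big_nat_recr //=; apply: (@le_trans _ _ (H n.+2 / c n.+1)).
  by rewrite mulrBl; lra.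
by rewrite ler_wpM2l ?lef_pV2 ?H0 //= leqnn.
Qed.

End GradientAscent.

(** * Time averages under admissible step sizes *)

Section Averages.
Context {R : realType}.

Lemma littleo_average (f : nat -> R) :
  f =o_\oo (fun T : nat => T%:R : R) ->
  (fun T : nat => T%:R^-1 * f T) @ \oo --> (0 : R).
Proof.
move=> /eqoP fo; apply/cvgr0Pnorm_le => e e0; near=> T.
have T0 : 0 < T%:R :> R by rewrite ltr0n; near: T; exact: nbhs_infty_gt.
have fT : `|f T| <= e * `|T%:R : R| by near: T; exact: fo.
by rewrite normrM normfV mulrC ler_pdivrMr ?normr_gt0 ?gt_eqF.
Unshelve. all: by end_near.
Qed.

(** Dividing by [eta T t] and summing leaves [M / eta T T] and [C] times the sum of the step sizes,
    both [o(T)]. *)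
Lemma ascent_average (eta H q : nat -> nat -> R) (M C : R) :
  admissible_steps eta -> 0 <= M -> 0 <= C ->
  (forall T t, (1 <= t <= T)%N -> 0 <= H T t <= M) ->
  (forall T t, (1 <= t <= T)%N -> 0 <= q T t <= 1) ->
  (forall T t, (1 <= t < T)%N ->
     eta T t * q T t - C * eta T t ^+ 2 <= H T t.+1 - H T t) ->
  (fun T : nat => T%:R^-1 * \sum_(1 <= t < T.+1) q T t) @ \oo --> (0 : R).
Proof.
move=> [eta0 eta_dec etaV_o eta_o] M0 C0 HM q01 step.
pose V (T : nat) : R := T%:R^-1 * (eta T T)^-1.
pose W (T : nat) : R := T%:R^-1 * \sum_(1 <= t < T.+1) eta T t.
have V_0 : V @ \oo --> (0 : R) by exact: littleo_average.
have W_0 : W @ \oo --> (0 : R) by exact: littleo_average.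
have T_0 : (fun T : nat => T%:R^-1 : R) @ \oo --> (0 : R).
  apply/gtr0_cvgV0; last exact: cvgr_idn.
  by near=> T; rewrite ltr0n; near: T; exact: nbhs_infty_gt.
apply: (@squeeze_cvgr _ _ _ _ (fun=> 0)
  (fun T : nat => M * V T + C * W T + T%:R^-1)); last first.
- rewrite -[0 in X in _ --> X](_ : M * 0 + C * 0 + 0 = 0); last by rewrite !mulr0 !addr0.
  by apply: cvgD => //; apply: cvgD; apply: cvgM => //; exact: cvg_cst.
- exact: cvg_cst.
near=> T.
have : (0 < T)%N by near: T; exact: nbhs_infty_gt.
case: (T) => // n _; apply/andP; split.
  rewrite mulr_ge0 ?invr_ge0 // big_seq_cond sumr_ge0 // => t.
  by rewrite mem_index_iota andbT ltnS => /q01 /andP[].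
have -> : M * V n.+1 + C * W n.+1 + n.+1%:R^-1 =
    n.+1%:R^-1 * (M / eta n.+1 n.+1 + C * \sum_(1 <= t < n.+2) eta n.+1 t + 1).
  by rewrite /V /W; ring.
rewrite ler_wpM2l ?invr_ge0 //.
(* The last period is followed by no update; its term is at most 1, hence the summand [T%:R^-1] in
   the upper bound. *)
rewrite big_nat_recr //= [in leRHS]big_nat_recr //=.
have qn : q n.+1 n.+1 <= 1.
  by have /andP[] : 0 <= q n.+1 n.+1 <= 1 by apply: q01; rewrite leqnn.
have en : 0 < eta n.+1 n.+1 by apply: eta0; rewrite leqnn.
have Ce : 0 <= C * eta n.+1 n.+1 by rewrite mulr_ge0 // ltW.
have HMn : H n.+1 n.+1 / eta n.+1 n.+1 <= M / eta n.+1 n.+1.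
  rewrite ler_wpM2r ?invr_ge0 ?(ltW en) //.
  by have /andP[] : 0 <= H n.+1 n.+1 <= M by apply: HM; rewrite leqnn.
have sq : \sum_(1 <= t < n.+1) q n.+1 t <=
    \sum_(1 <= t < n.+1) (H n.+1 t.+1 - H n.+1 t) / eta n.+1 t
    + C * \sum_(1 <= t < n.+1) eta n.+1 t.
  rewrite mulr_sumr -big_split /= [leLHS]big_seq_cond [leRHS]big_seq_cond.
  apply: ler_sum => t; rewrite mem_index_iota andbT => tn.
  have /andP[t1 tn'] := tn.
  have et : 0 < eta n.+1 t by apply: eta0; rewrite t1 ltnW.
  rewrite -lerBlDr ler_pdivlMr // mulrBl.
  have := step n.+1 t tn; rewrite expr2 mulrA; lra.
have : \sum_(1 <= t < n.+1) (H n.+1 t.+1 - H n.+1 t) / eta n.+1 t <=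
    H n.+1 n.+1 / eta n.+1 n.+1.
  apply: abel_bound => t /andP[t1 tn].
  - by have /andP[] : 0 <= H n.+1 t <= M by apply: HM; rewrite t1.
  - by apply: eta0; rewrite t1.
  - by apply: eta_dec.
rewrite mulrDr; lra.
Unshelve. all: by end_near.
Qed.

End Averages.

(** * The weighted inequality and the convergence of play *)

Theorem theorem3p2 (R : realType) (N : finType) (A : N -> finType)
    (A_nonempty : forall i, (0 < #|A i|)%N) (u : N -> pure_profile A -> R)
    (K : nat) (K_gt0 : (0 < K)%N)
    (Al A'l : nat -> forall i, {set A i})
    (h : forall l, profile_space R (subaction (Al l)) -> R)
    (run : iepp_run u K Al A'l h)
    (hhat : nat -> profile_space R A -> R)
    (hhat_extends : forall l, (l < K)%N ->
       forall x, face (Al l) x -> hhat l x = h l (to_subgame (Al l) x))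
    (hhat_tangential : forall l, (l < K)%N -> tangential (hhat l))
    (hhat_lipschitz : forall l, (l < K)%N -> lipschitz_differentiable (hhat l))
    (hhat_partial0 : forall l, (l < K)%N ->
       forall (i : N) (a : A i), a \notin Al l i ->
       forall x, face (Al l) x -> partial (hhat l) x a = 0) :
  (exists eps : nat -> R,
     (forall l, (l < K)%N -> 0 < eps l) /\
     forall x : profile_space R A, mixed_profile x ->
       \sum_(l < K) \sum_i \sum_(a : A i)
           (eps l * partial (hhat l) x a) * partial (mixed_utility (u i)) x a
       >= prob_some x (fun i => ~: Al K i)%SET)
  /\
  (forall (eta : nat -> nat -> R) (x : nat -> nat -> profile_space R A),
     admissible_steps eta ->
     gradient_ascent u eta x ->
     (fun T : nat => T%:R^-1 *
        \sum_(1 <= t < T.+1) prob_some (x T t) (fun i => ~: Al K i)%SET)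
       @ \oo --> (0 : R)).
Proof.
have Al0 : forall i, Al 0%N i = [set: A i]%SET by have [] := run.
have stage l (lK : (l < K)%N) : exists2 c : R, 0 <= c &
    forall x : profile_space R A, mixed_profile x ->
      prob_some x (fun i => ~: Al l.+1 i)%SET
        - c * prob_some x (fun i => ~: Al l i)%SET <= gain u (hhat l) x.
  have [_ /(_ l lK)[A'_proper elim AlS]] := run.
  (* The retraction onto the face needs a remaining action for each player; a set with a proper
     subset is nonempty. *)
  have Al_neq0 i : Al l i != finset.set0.
    by rewrite -card_gt0; apply: leq_ltn_trans (proper_card (A'_proper i)).
  have [c c0 hc] := elimination_bound Al_neq0 (hhat_lipschitz l lK)
    (hhat_tangential l lK) (hhat_extends l lK)
    (fun i a aAl y => hhat_partial0 l lK i a aAl y) elim.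
  exists c => // x xD.
  have -> : (fun i => ~: Al l.+1 i)%SET = (fun i => ~: (Al l i :\: A'l l i))%SET.
    by apply/functional_extensionality_dep => i; rewrite AlS.
  exact: hc.
(* From [K] on, 0 is a default that makes [c] a total function. *)
have /choice[c hc] : forall l, exists c : R, (l < K)%N -> 0 <= c /\
    forall x : profile_space R A, mixed_profile x ->
      prob_some x (fun i => ~: Al l.+1 i)%SET
        - c * prob_some x (fun i => ~: Al l i)%SET <= gain u (hhat l) x.
  move=> l; have [lK|_] := boolP (l < K)%N; last by exists 0.
  by have [d d0 hd] := stage l lK; exists d.
have [e e0 he] := @geometric_weights R c K (fun l lK => (hc l lK).1).
have total (x : profile_space R A) : mixed_profile x ->
    prob_some x (fun i => ~: Al K i)%SET <=
    \sum_(l < K) e l * gain u (hhat l) x.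
  move=> xD.
  apply: (he (fun l => prob_some x (fun i => ~: Al l i)%SET)
             (fun l => gain u (hhat l) x)).
  - by apply: prob_some0 => i; rewrite Al0 finset.setCT.
  - by move=> l; exact: prob_some_ge0.
  - by move=> l /hc[_]; exact.
split.
  exists e; split=> // x xD; apply: (le_trans (total x xD)).
  rewrite le_eqVlt; apply/orP; left; apply/eqP; apply: eq_bigr => l _.
  rewrite /gain mulr_sumr; apply: eq_bigr => i _; rewrite mulr_sumr.
  by apply: eq_bigr => a _; rewrite mulrA.
move=> eta x eta_ok xGA.
(* The first profile is mixed by assumption, later ones as projections. *)
have xD T t : (1 <= t <= T)%N -> mixed_profile (x T t).
  case: t => // t tT; have [x1 xS] := xGA T (leq_trans (ltn0Sn t) tT).
  case: t tT => // t tT.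
  exact: (gradient_ascent_step_mixed (xS t.+1 tT)).
have /choice[d hd] : forall l, exists d : R, (l < K)%N -> 0 <= d /\
    forall (s : R) (y z : profile_space R A), 0 < s ->
      mixed_profile y -> gradient_ascent_step u s y z ->
      s * gain u (hhat l) y - d * s ^+ 2 <= hhat l z - hhat l y.
  move=> l; have [lK|_] := boolP (l < K)%N; last by exists 0.
  have [d d0 hd] :=
    gradient_ascent_step_gain u (hhat_lipschitz l lK) (hhat_tangential l lK).
  by exists d.
pose H (y : profile_space R A) := \sum_(l < K) e l * hhat l y.
have [M M0 HM] : bounded_lipschitz mixed_profile H.
  apply: bounded_lipschitz_sum => l _; apply: bounded_lipschitzM.
    exact: bounded_lipschitz_cst.
  exact/bounded_lipschitz_differentiable/hhat_lipschitz.
(* Adding [M] makes the weighted potential nonnegative, with values up to [M + M], and keeps its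
   increments. *)
apply: (@ascent_average R eta (fun T t => H (x T t) + M) _ (M + M)
  (\sum_(l < K) e l * d l)) => //.
- exact: addr_ge0.
- by apply: sumr_ge0 => l _; rewrite mulr_ge0 ?(hd l _).1 // ltW ?e0.
- move=> T t tT; have [+ _] := HM _ _ (xD T t tT) (xD T t tT).
  by rewrite ler_norml => /andP[Hge Hle]; apply/andP; split; lra.
- by move=> T t /xD tD; rewrite prob_some_ge0 ?prob_some_le1.
move=> T t /andP[t1 tT].
have tD : mixed_profile (x T t) by apply: xD; rewrite t1 ltnW.
have eta_gt0 : 0 < eta T t.
  by have [eta0 _ _ _] := eta_ok; apply: eta0; rewrite t1 ltnW.
have xstep : gradient_ascent_step u (eta T t) (x T t) (x T t.+1).
  have [_ xS] := xGA T (leq_ltn_trans (leq0n t) tT).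
  by apply: xS; rewrite t1.
have -> : H (x T t.+1) + M - (H (x T t) + M) = H (x T t.+1) - H (x T t) by ring.
(* The ascent inequalities of the stages are added with the weights [e]; [total] bounds the combined
   gain from below. *)
apply: (@le_trans _ _ (\sum_(l < K) e l *
    (eta T t * gain u (hhat l) (x T t) - d l * eta T t ^+ 2))).
  have -> : \sum_(l < K) e l *
      (eta T t * gain u (hhat l) (x T t) - d l * eta T t ^+ 2) =
    eta T t * (\sum_(l < K) e l * gain u (hhat l) (x T t)) -
      (\sum_(l < K) e l * d l) * eta T t ^+ 2.
    rewrite mulr_sumr mulr_suml -sumrB; apply: eq_bigr => l _; ring.
  by rewrite lerD2r ler_wpM2l ?total // ltW.
rewrite /H -sumrB; apply: ler_sum => l _; rewrite -mulrBr.
by rewrite ler_wpM2l ?(hd l _).2 // ltW ?e0.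
Qed.
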